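(* Let $n\ge1$, let $F$ be admissible on $[0,\infty)$, and let $d=n/2$. Then $U_d[\phi]$ possesses the eventual $F$-concavity property for all $\phi\in\mathcal{L}$ if and only if $F$-concavity is weaker than log-concavity in $\mathcal{A}([0,\infty))$.
   Context: $\mathcal{L}$ is the set of nontrivial (not a.e. zero), nonnegative, bounded measurable functions on $\mathbb{R}^n$ with compact support. For $\phi\in\mathcal{L}$, $(e^{t\Delta}\phi)(x):=(4\pi t)^{-n/2}\int_{\mathbb{R}^n}e^{-|x-y|^2/(4t)}\phi(y)\,dy$ and $U_d[\phi](x,t):=(4\pi t)^d(e^{t\Delta}\phi)(x)$ for $(x,t)\in\mathbb{R}^n\times(0,\infty)$. Let $I=[0,\infty)$. A function $F:I\to[-\infty,\infty)$ is admissible on $I$ if $F$ is continuous on $(0,\infty)$, strictly increasing on $I$, and $F(0)=-\infty$. $\mathcal{A}(I)$ is the set of $I$-valued functions on $\mathbb{R}^n$. $f\in\mathcal{A}(I)$ is $F$-concave in $\mathbb{R}^n$ if $F(f((1-\mu)x+\mu y))\ge(1-\mu)F(f(x))+\mu F(f(y))$ for all $x,y\in\mathbb{R}^n$, $\mu\in(0,1)$; $\mathcal{C}[F]$ denotes the set of $F$-concave functions. For admissible $F_1,F_2$ on $I$, $F_1$-concavity is weaker than $F_2$-concavity in $\mathcal{A}(I)$ if $\mathcal{C}[F_2]\subset\mathcal{C}[F_1]$. Log-concavity is $F$-concavity for $F=\log$ (with $\log0=-\infty$). $U_d[\phi]$ possesses the eventual $F$-concavity property if there exists $T>0$ such that $U_d[\phi](\cdot,t)$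 is $F$-concave in $\mathbb{R}^n$ for all $t\in[T,\infty)$. *)

(* Defs.v *)
From HB Require Import structures.
From mathcomp Require Import all_boot all_order all_algebra.
From mathcomp Require Import all_classical all_reals all_analysis.
From mathcomp Require Import measurable_realfun.

Set Implicit Arguments.
Unset Strict Implicit.
Unset Printing Implicit Defensive.

Import Order.TTheory GRing.Theory Num.Theory.
Import numFieldNormedType.Exports.

Local Open Scope classical_set_scope.
Local Open Scope ring_scope.

(* R^n is 'rV[R]_n, with the product (= Borel) sigma-algebra. *)
Section measurable_rV.
Context {R : realType} (n : nat).

Definition rV_display : measure_display -> measure_display.
Proof. exact. Qed.

Definition coord_rV (i : 'I_n) (v : 'rV[R]_n) : R := v ord0 i.

Let rV_set0 : g_sigma_preimage coord_rV set0.
Proof. exact: sigma_algebra0. Qed.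

Let rV_setC A : g_sigma_preimage coord_rV A -> g_sigma_preimage coord_rV (~` A).
Proof. exact: sigma_algebraC. Qed.

Let rV_bigcup (F : (set 'rV[R]_n)^nat) :
  (forall i, g_sigma_preimage coord_rV (F i)) ->
  g_sigma_preimage coord_rV (\bigcup_i (F i)).
Proof. exact: sigma_algebra_bigcup. Qed.

HB.instance Definition _ := @isMeasurable.Build (rV_display default_measure_display)
  'rV[R]_n (g_sigma_preimage coord_rV) rV_set0 rV_setC rV_bigcup.

End measurable_rV.

Lemma measurable_coord_rV (R : realType) n (i : 'I_n) :
  measurable_fun [set: 'rV[R]_n] (coord_rV i).
Proof.
move=> _ Y mY; rewrite setTI; apply: sub_sigma_algebra => /=.
rewrite -bigcup_seq/=; exists i => /=; first by rewrite mem_index_enum.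
by exists Y => //; rewrite setTI.
Qed.

Lemma measurable_fun_rVP (R : realType) n d (T : measurableType d)
    (f : T -> 'rV[R]_n) :
  measurable_fun [set: T] f <->
  forall i, measurable_fun [set: T] (coord_rV i \o f).
Proof.
apply: (@iff_trans _ (g_sigma_preimage
    (fun i => @coord_rV R n i \o f) `<=` measurable)).
  rewrite g_sigma_preimage_comp; split=> [mf A [/= C preC <-]|prefS].
    exact: mf.
  by move=> _ A mA; apply: prefS; exists A.
split=> [fS i|mf].
- move=> _ A mA; apply: fS; apply: sub_sigma_algebra.
  rewrite -bigcup_seq/=; exists i => /=; first by rewrite mem_index_enum.
  by exists A.
- apply: smallest_sub; first exact: sigma_algebra_measurable.
  rewrite -bigcup_seq/=; apply: bigcup_sub => i _.
  by move=> A [B mB <-]; exact: mf.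
Qed.

Definition cons_rV {R : realType} {n} (p : R * 'rV[R]_n) : 'rV[R]_n.+1 :=
  row_mx (const_mx p.1 : 'rV[R]_1) p.2.

Definition uncons_rV {R : realType} {n} (v : 'rV[R]_n.+1) : R * 'rV[R]_n :=
  (v ord0 ord0, \row_i v ord0 (lift ord0 i)).

Lemma cons_rV0 (R : realType) n (p : R * 'rV[R]_n) : cons_rV p ord0 ord0 = p.1.
Proof. by rewrite /cons_rV mxE; case: splitP => // j _; rewrite mxE. Qed.

Lemma cons_rVS (R : realType) n (p : R * 'rV[R]_n) i :
  cons_rV p ord0 (lift ord0 i) = p.2 ord0 i.
Proof.
rewrite /cons_rV mxE; case: splitP => [[[]//]|j] /eqP.
by rewrite eqSS => /eqP ij; congr (p.2 _ _); apply: val_inj.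
Qed.

Lemma cons_rVK (R : realType) n : cancel (@cons_rV R n) uncons_rV.
Proof.
move=> p; rewrite /uncons_rV cons_rV0 [RHS]surjective_pairing; congr pair.
by apply/rowP => i; rewrite mxE cons_rVS.
Qed.

Lemma uncons_rVK (R : realType) n : cancel (@uncons_rV R n) cons_rV.
Proof.
move=> v; apply/rowP => i; case: (unliftP ord0 i) => [j ->|->].
  by rewrite cons_rVS mxE.
by rewrite cons_rV0.
Qed.

Lemma measurable_cons_rV (R : realType) n :
  measurable_fun [set: R * 'rV[R]_n] (@cons_rV R n).
Proof.
apply/measurable_fun_rVP => i; case: (unliftP ord0 i) => [j ->|->].
  rewrite (_ : _ \o _ = coord_rV j \o snd); last first.
    by apply/funext => p; exact: cons_rVS.
  exact: measurableT_comp (measurable_coord_rV _) measurable_snd.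
rewrite (_ : _ \o _ = fst); first exact: measurable_fst.
by apply/funext => p; exact: cons_rV0.
Qed.

Lemma measurable_uncons_rV (R : realType) n :
  measurable_fun [set: 'rV[R]_n.+1] (@uncons_rV R n).
Proof.
apply: measurable_fun_pair; first exact: measurable_coord_rV.
apply/measurable_fun_rVP => i.
rewrite (_ : _ \o _ = coord_rV (lift ord0 i)); first exact: measurable_coord_rV.
by apply/funext => v; rewrite /= /coord_rV mxE.
Qed.

Section lebesgue_rV_step.
Context {R : realType} (n : nat).
Variable m : {sigma_finite_measure set 'rV[R]_n -> \bar R}.
Local Open Scope ereal_scope.

Definition lebesgue_rV_step : set 'rV[R]_n.+1 -> \bar R :=
  pushforward (@lebesgue_measure R \x m) cons_rV.

Let mcons : measurable_fun [set: R * 'rV[R]_n] (@cons_rV R n) :=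
  @measurable_cons_rV R n.

Let step0 : lebesgue_rV_step set0 = 0.
Proof. by rewrite /lebesgue_rV_step /pushforward preimage_set0 measure0. Qed.

Let step_ge0 A : 0 <= lebesgue_rV_step A.
Proof. exact: measure_ge0. Qed.

Let step_sigma_additive : semi_sigma_additive lebesgue_rV_step.
Proof.
move=> F mF tF mUF; rewrite /lebesgue_rV_step /pushforward preimage_bigcup.
apply: measure_semi_sigma_additive.
- by move=> k; rewrite -[X in measurable X]setTI; exact: mcons.
- apply/trivIsetP => /= i j _ _ ij; rewrite -preimage_setI.
  by move/trivIsetP : tF => /(_ _ _ _ _ ij) ->//; rewrite preimage_set0.
- by rewrite -preimage_bigcup -[X in measurable X]setTI; exact: mcons.
Qed.

HB.instance Definition _ := isMeasure.Build _ _ _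
  lebesgue_rV_step step0 step_ge0 step_sigma_additive.

Let step_sigma_finite : sigma_finite [set: 'rV[R]_n.+1] lebesgue_rV_step.
Proof.
have [F FT Foo] : sigma_finite setT (@lebesgue_measure R \x m).
  have /sigma_finiteP[F [TF ndF Foo]] := sigma_finiteT (@lebesgue_measure R).
  have /sigma_finiteP[G [TG ndG Goo]] := sigma_finiteT m.
  exists (fun k => F k `*` G k).
    rewrite -setXTT TF TG predeqE => -[x y]; split.
      move=> [/= [k _ Fkx] [l _ Gly]]; exists (maxn k l) => //; split.
      - by move: x Fkx; exact/subsetPset/ndF/leq_maxl.
      - by move: y Gly; exact/subsetPset/ndG/leq_maxr.
    by move=> [k _ []/= ? ?]; split; exists k.
  move=> k; have [? ?] := Foo k; have [? ?] := Goo k.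
  split; first exact: measurableX.
  by rewrite product_measure1E// lte_mul_pinfty// ge0_fin_numE.
exists (fun k => @uncons_rV R n @^-1` F k).
  by rewrite -preimage_bigcup -FT preimage_setT.
move=> k; have [mF Fk] := Foo k; split.
  by rewrite -[X in measurable X]setTI; exact: measurable_uncons_rV.
rewrite /lebesgue_rV_step /pushforward -comp_preimage.
rewrite (_ : _ \o _ = id)// ; apply/funext => p; exact: cons_rVK.
Qed.

HB.instance Definition _ := Measure_isSigmaFinite.Build _ _ _
  lebesgue_rV_step step_sigma_finite.

End lebesgue_rV_step.

(* n-dimensional Lebesgue measure: n-fold product of lebesgue_measure, the
   one-point space 'rV_0 carrying a Dirac mass. *)
Fixpoint lebesgue_rV {R : realType} (n : nat) :
    {sigma_finite_measure set 'rV[R]_n -> \bar R} :=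
  match n with
  | 0 => @dirac _ 'rV[R]_0 0 R
  | n'.+1 => lebesgue_rV_step (lebesgue_rV n')
  end.

Section heat.
Context {R : realType} {n : nat}.
Implicit Types (phi f : 'rV[R]_n -> R) (x y : 'rV[R]_n) (d t : R).

(* The norm of 'rV[R]_n in the library is the sup norm, not the Euclidean one. *)
Definition sqdist x y : R := \sum_(i < n) (x ord0 i - y ord0 i) ^+ 2.

(* Lebesgue (not just Borel) measurability: [completed_algebra_gen mu] consists
   of the sets A `|` N with A Borel and N contained in a Borel null set. *)
Definition lebesgue_measurable phi : Prop :=
  forall B : set R, measurable B ->
    completed_algebra_gen (@lebesgue_rV R n) (phi @^-1` B).

Definition classL phi : Prop :=
  [/\ lebesgue_measurable phi,
      ~ {ae @lebesgue_rV R n, forall x, phi x = 0},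
      forall x, 0 <= phi x,
      exists M, forall x, phi x <= M
    & compact (closure [set x | phi x != 0])].

Definition heat t phi x : R :=
  (4 * pi * t) `^ (- (n%:R / 2)) *
  \int[@lebesgue_rV R n]_y (expR (- (sqdist x y / (4 * t))) * phi y).

Definition U d phi x t : R := (4 * pi * t) `^ d * heat t phi x.

(* F : [0, +oo[ -> [-oo, +oo[ is represented by a function R -> \bar R of which
   only the restriction to [0, +oo[ is ever used. *)
Definition admissible (F : R -> \bar R) : Prop :=
  [/\ forall r, 0 <= r -> F r != +oo%E,
      {within `]0, +oo[, continuous F},
      forall r s, 0 <= r -> r < s -> (F r < F s)%E
    & F 0 = -oo%E].

Definition calA : set ('rV[R]_n -> R) := [set f | forall x, 0 <= f x].

Definition concave_class (F : R -> \bar R) : set ('rV[R]_n -> R) :=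
  [set f | calA f /\
     forall x y (mu : R), 0 < mu -> mu < 1 ->
       ((1 - mu)%:E * F (f x) + mu%:E * F (f y) <=
        F (f ((1 - mu) *: x + mu *: y)%R))%E].

Definition eventually_concave (F : R -> \bar R) (u : 'rV[R]_n -> R -> R) : Prop :=
  exists T : R, 0 < T /\ forall t, T <= t -> concave_class F (u ^~ t).

End heat.

Definition weaker_concavity {R : realType} (n : nat) (F1 F2 : R -> \bar R) : Prop :=
  @concave_class R n F2 `<=` @concave_class R n F1.

(* lne (0%:E) = -oo *)
Definition logF {R : realType} : R -> \bar R := fun r => lne r%:E.

(* Main.v *)
(* For [d = n/2] the powers of [t] cancel and [U] is the convolution of [phi]
   with [exp (-|x|^2 / 4t)].

   If F-concavity is weaker than log-concavity, it suffices that [U] is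
   eventually log-concave. Along [z + l h], [U] is a Gaussian factor
   [exp (-l^2 |h|^2 / 4t)] times the exponential moment at [l] of a measure
   supported in an interval of length [O(|h| / t)]; a Hoeffding-type bound
   makes that moment at most [U z * exp (l m + O(l^2 |h|^2 / t^2))], and for
   large [t] the Gaussian factor absorbs the quadratic term. So [U] has a
   supporting exponential at each point, i.e. it is log-concave.

   Conversely, for multiples of the indicator of a cube, [U (2 sqrt t r e1, t)]
   tends to [exp (c - r^2)] with [c] arbitrary, so with [G = F o exp] the
   function [r |-> G (c - r^2)] is concave for every [c]. Zooming in at
   [r ~ sqrt c] as [c -> oo] shows that [G] itself is concave, which says that
   log-concave functions are F-concave. *)
Require Import Defs.
From mathcomp Require Import all_boot all_order all_algebra.
From mathcomp Require Import all_classical all_reals all_analysis.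
From mathcomp Require Import measurable_realfun ring lra.
Import Order.TTheory GRing.Theory Num.Theory.
Import numFieldNormedType.Exports.
Import HBNNSimple.
Local Open Scope classical_set_scope.
Local Open Scope ring_scope.

(** * Exponential moments of a bounded function *)

(** The pointwise source of the Hoeffding bound: for a centred variable the linear term integrates
    to zero. For [x >= 1 / 2] one has [x <= 2 * x ^+ 2]; below that, [expR x <= 1 / (1 - x) <= 1 + x
    + 2 * x ^+ 2]. *)
Lemma expR_le_addx_expR_sqr (R : realType) (x : R) : expR x <= x + expR (2 * x ^+ 2).
Proof.
have [x_big|x_small] := leP (1 / 2) x.
  have -> : expR x = 0 + expR x by rewrite add0r.
  apply: lerD; first lra.
  by rewrite ler_expR; nra.
have e1 : 1 - x <= expR (- x) by have := expR_ge1Dx (- x); lra.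
have e2 : expR x * expR (- x) = 1 by rewrite -expRD subrr expR0.
have e0 := expR_gt0 x.
have e3 : expR x * (1 - x) <= 1 by rewrite -[leRHS]e2 ler_pM2l.
have e4 : 1 + 2 * x ^+ 2 <= expR (2 * x ^+ 2) := expR_ge1Dx _.
have : 0 <= x ^+ 2 by exact: sqr_ge0.
have : expR x <= 1 + x + 2 * x ^+ 2; last lra.
rewrite -(ler_pM2r (_ : 0 < 1 - x)); last lra.
apply: (le_trans e3); nra.
Qed.

Lemma integrable_bounded_mul {d} {T : measurableType d} {R : realType}
    {mu : {measure set T -> \bar R}} {g : T -> R} (h : T -> R) (K : R) :
  (forall x, 0 <= g x) -> mu.-integrable setT (EFin \o g) ->
  measurable_fun setT h -> (forall x, g x != 0 -> `|h x| <= K) ->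
  mu.-integrable setT (EFin \o (fun x => h x * g x)).
Proof.
move=> g0 ig mh hK.
have mg : measurable_fun setT g by exact/measurable_EFinP/(measurable_int mu).
have := @integrableZl _ _ _ mu _ measurableT K _ ig.
apply: le_integrable => //.
  by apply/measurable_EFinP; exact: measurable_funM.
move=> x _ /=; rewrite lee_fin normrM.
have [->|gx0] := eqVneq (g x) 0; first by rewrite mulr0 normr0 mulr0.
rewrite [leRHS]normrM; apply: ler_wpM2r => //.
exact: (le_trans (hK _ gx0)) (ler_norm _).
Qed.

(* The witness [m] is the mean of [s] for the probability proportional to [g]. *)
Lemma exp_moment_le {d} {T : measurableType d} {R : realType}
    {mu : {measure set T -> \bar R}} {g s : T -> R} {c b : R} :
  (forall x, 0 <= g x) -> mu.-integrable setT (EFin \o g) ->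
  measurable_fun setT s -> (forall x, g x != 0 -> `|s x - c| <= b) ->
  0 < (\int[mu]_x g x)%R ->
  exists m, forall l, (\int[mu]_x (expR (l * s x) * g x)
    <= expR (l * m + 8 * (l * b) ^+ 2) * \int[mu]_x g x)%R.
Proof.
move=> g0 ig ms scb; set I := (X in 0 < X) => I0.
have isg : mu.-integrable setT (EFin \o (fun x => s x * g x)).
  apply: (integrable_bounded_mul s (`|c| + b)) => // x /scb.
  by have := ler_normD (s x - c) c; rewrite subrK; lra.
have icg k : mu.-integrable setT (EFin \o (fun x => k * g x)).
  by apply: (integrable_bounded_mul (cst k) `|k|).
have gle (h1 h2 : T -> R) : (forall x, g x != 0 -> h1 x <= h2 x) ->
    forall x, setT x -> h1 x * g x <= h2 x * g x.
  move=> h12 x _; have [->|gx0] := eqVneq (g x) 0; first by rewrite !mulr0.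
  by apply: ler_wpM2r => //; exact: h12.
pose m := (\int[mu]_x (s x * g x))%R / I.
have mI : (\int[mu]_x (s x * g x))%R = m * I by rewrite divfK// gt_eqF.
(* The mean stays in the same interval as [s], hence [s] differs from [m] by at most [2 * b] where
   [g] is nonzero. This gives the constant [8 = 2 * 2 ^+ 2]. *)
have mc : `|m - c| <= b.
  rewrite ler_norml; apply/andP; split.
    have : c - b <= m; last lra.
    rewrite -(ler_pM2r I0) -mI -RintegralZl//; apply: le_Rintegral => //.
    by apply: (gle (fun=> c - b)) => x /scb; rewrite ler_norml => /andP[? ?]; lra.
  have : m <= c + b; last lra.
  rewrite -(ler_pM2r I0) -mI -RintegralZl//; apply: le_Rintegral => //.
  by apply: (gle _ (fun=> c + b)) => x /scb; rewrite ler_norml => /andP[? ?]; lra.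
exists m => l.
set e := expR (l * m).
(* [e * l * s x + B] is [e * (l * (s x - m) + expR (8 * (l * b) ^+ 2))], an affine majorant of
   [expR (l * s x)] whose linear part has zero [g]-weighted integral. *)
pose B := e * (expR (8 * (l * b) ^+ 2) - l * m).
have -> : expR (l * m + 8 * (l * b) ^+ 2) * I =
    (\int[mu]_x ((e * l) * (s x * g x) + B * g x))%R.
  rewrite RintegralD//; last first.
    rewrite (_ : _ \o _ = EFin \o (fun x => ((e * l) * s x) * g x)).
      apply: (integrable_bounded_mul _ (`|e * l| * (`|c| + b))) => //.
        exact: measurable_funM.
      move=> x /scb sb; rewrite normrM ler_wpM2l//.
      by have := ler_normD (s x - c) c; rewrite subrK; lra.
    by apply/funext => x /=; rewrite mulrA.
  by rewrite !RintegralZl// mI expRD -/e /B -/I; ring.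
apply: le_Rintegral => //.
- apply: (integrable_bounded_mul _ (expR (`|l| * (`|c| + b)))) => //.
    by apply: measurableT_comp => //; exact: measurable_funM.
  move=> x /scb sb; rewrite ger0_norm ?expR_ge0// ler_expR.
  apply: (le_trans (ler_norm _)); rewrite normrM ler_wpM2l//.
  by have := ler_normD (s x - c) c; rewrite subrK; lra.
- rewrite (_ : _ \o _ = EFin \o (fun x => ((e * l) * s x + B) * g x)).
    apply: (integrable_bounded_mul _ (`|e * l| * (`|c| + b) + `|B|)) => //.
      by apply: measurable_funD => //; exact: measurable_funM.
    move=> x /scb sb; apply: (le_trans (ler_normD _ _)); rewrite lerD2r.
    rewrite normrM ler_wpM2l//.
    by have := ler_normD (s x - c) c; rewrite subrK; lra.
  by apply/funext => x /=; rewrite mulrDl mulrA.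
- move=> x xT; rewrite [leRHS](_ : _ = (e * l * s x + B) * g x); last ring.
  apply: (gle (fun x => expR (l * s x)) (fun x => e * l * s x + B)) => // {xT}x /scb sb.
  have -> : l * s x = l * m + l * (s x - m) by ring.
  rewrite expRD -/e.
  have -> : e * l * s x + B = e * (l * (s x - m) + expR (8 * (l * b) ^+ 2)).
    by rewrite /B; ring.
  rewrite ler_pM2l ?expR_gt0//.
  apply: (le_trans (expR_le_addx_expR_sqr _ _)); rewrite lerD2l ler_expR.
  have : (s x - m) ^+ 2 <= (2 * b) ^+ 2.
    rewrite -[leLHS]real_normK ?num_real// lerXn2r ?nnegrE//.
      by have := le_trans (normr_ge0 _) sb; lra.
    by have := ler_distD c (s x) m; rewrite (distrC c m); lra.
  move=> /(ler_wpM2l (sqr_ge0 l)).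
  by rewrite -exprMn; lra.
Qed.

(** * From Lebesgue measurable to Borel functions *)

(** Each superlevel set of [phi] at a rational [q] is a measurable set [A] plus a negligible set
    [N]. The minorant is the supremum over [q] of [max 0 q] times the indicator of [A]; off the
    countable union of the sets [N], density of the rationals gives equality. *)
Lemma borel_minorant {d} {T : measurableType d} {R : realType}
    {mu : {measure set T -> \bar R}} {phi : T -> R} :
  (forall B : set R, measurable B -> completed_algebra_gen mu (phi @^-1` B)) ->
  (forall x, 0 <= phi x) ->
  exists psi : T -> R, [/\ measurable_fun setT psi, forall x, 0 <= psi x,
    forall x, psi x <= phi x & {ae mu, forall x, psi x = phi x}].
Proof.
move=> mphi phi0.
have /choice[AN ANP] (q : rat) : exists AN : set T * set T,
    [/\ measurable AN.1, mu.-negligible AN.2 &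
        AN.1 `|` AN.2 = phi @^-1` `]ratr q, +oo[].
  have [A mA [N nN AN]] := mphi `]ratr q, +oo[%classic (measurable_itv _).
  by exists (A, N).
(* Rationals are enumerated by [unpickle]; the default 0 and the truncation at 0 stay below [phi]
   because [phi] is nonnegative. *)
pose h (k : nat) (x : T) : R :=
  if unpickle k is Some q then Num.max 0 (ratr q) * \1_(AN q).1 x else 0.
have h_ge0 k x : 0 <= h k x.
  by rewrite /h; case: unpickle => // q; rewrite mulr_ge0// le_max lexx.
have h_le k x : h k x <= phi x.
  rewrite /h; case: unpickle => // q; rewrite indicE.
  have [xA|_] := boolP (x \in _); last by rewrite mulr0.
  rewrite mulr1 ge_max phi0/=.
  have [_ _ ANE] := ANP q.
  have : (phi @^-1` `]ratr q, +oo[) x by rewrite -ANE; left; exact/set_mem.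
  by rewrite /= in_itv/= andbT => /ltW.
have h_ub x : has_ubound (range (h ^~ x)).
  by exists (phi x) => _ [k _ <-].
have supsE x : sups (h ^~ x) 0 = sup (range (h ^~ x)).
  by congr sup; apply/seteqP; split => _ [k _ <-]; exists k.
exists (fun x => sups (h ^~ x) 0); split.
- apply: measurable_fun_sups => // k.
  rewrite /h; case: unpickle => [q|]; last exact: measurable_cst.
  apply: measurable_funM => //; apply: measurable_indic.
  by have [] := ANP q.
- move=> x; rewrite supsE.
  apply: (le_trans (h_ge0 0%N x)); apply: ub_le_sup => //; by exists 0%N.
- move=> x; rewrite supsE; apply: ge_sup.
    by exists (h 0%N x); exists 0%N.
  by move=> _ [k _ <-].
- have nN : mu.-negligible (\bigcup_k (if unpickle k is Some q then (AN q).2 else set0)).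
    apply: negligible_bigcup => k; case: unpickle => [q|].
      by have [] := ANP q.
    exact: negligible_set0.
  apply: negligibleS nN => x /= xpsi.
  apply: contrapT => xN; apply: xpsi; apply/eqP; rewrite eq_le.
  rewrite supsE; apply/andP; split.
    apply: ge_sup; first by exists (h 0%N x); exists 0%N.
    by move=> _ [k _ <-].
  rewrite leNgt; apply/negP => /rat_in_itvoo[q]; rewrite in_itv/= => /andP[sq qphi].
  have [_ _ ANE] := ANP q.
  have : (phi @^-1` `]ratr q, +oo[) x by rewrite /= in_itv/= qphi.
  rewrite -ANE => -[xA|xNq]; last first.
    by apply: xN; exists (pickle q); [exact: Logic.I|rewrite pickleK].
  suff : ratr q <= sup (range (h ^~ x)) by rewrite leNgt sq.
  apply: (@le_trans _ _ (h (pickle q) x)).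
    by rewrite /h pickleK indicE mem_set// mulr1 le_max lexx orbT.
  by apply: ub_le_sup; [exact: h_ub|exact: imageT].
Qed.

(* [f] need not be measurable: its integral is then a lower integral. *)
Lemma ge0_integral_minorant {d} {T : measurableType d} {R : realType}
    {mu : {measure set T -> \bar R}} {f g : T -> \bar R} :
  measurable_fun setT g -> (forall x, 0 <= g x)%E -> (forall x, g x <= f x)%E ->
  {ae mu, forall x, g x = f x} ->
  (\int[mu]_x f x = \int[mu]_x g x)%E.
Proof.
move=> mg g0 gf aefg; have f0 x : (0 <= f x)%E := le_trans (g0 x) (gf x).
apply/eqP; rewrite eq_le; apply/andP; split; last first.
  rewrite !ge0_integralTE//; apply: ereal_sup_le => _ [h /= hg <-].
  exists h => // x.
  exact: le_trans (hg x) (gf x).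
(* A simple function below [f] is almost everywhere below [g], so its integral is at most that of
   [g]. *)
rewrite ge0_integralTE//; apply: ge_ereal_sup => _ [h /= hf <-].
have := integral_nnsfun mu measurableT h; rewrite patch_setT => <-.
apply: ae_ge0_le_integral => //.
- by move=> x _; rewrite lee_fin fun_ge0.
- exact/measurable_EFinP.
- by apply: filterS aefg => x -> _.
Qed.

(** * Gaussian weights and cubes *)

Lemma U_half_dim {R : realType} {n} (phi : 'rV[R]_n -> R) x t : 0 < t ->
  U (n%:R / 2) phi x t =
  (\int[@lebesgue_rV R n]_y (expR (- (sqdist x y / (4 * t))) * phi y))%R.
Proof.
move=> t0; rewrite /U /heat mulrA powRN mulfV ?mul1r//.
by rewrite gt_eqF// powR_gt0// !mulr_gt0// pi_gt0.
Qed.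

Lemma measurable_sqdist {R : realType} {n} (x : 'rV[R]_n) :
  measurable_fun [set: 'rV[R]_n] (sqdist x).
Proof.
apply: measurable_sum => i; apply: measurable_funX; apply: measurable_funB => //.
exact: measurable_coord_rV.
Qed.

Lemma measurable_gauss {R : realType} {n} (x : 'rV[R]_n) (t : R) :
  measurable_fun [set: 'rV[R]_n] (fun y => expR (- (sqdist x y / (4 * t)))).
Proof.
apply: measurableT_comp => //; apply: measurableT_comp => //.
by apply: measurable_funM => //; exact: measurable_sqdist.
Qed.

Definition cube {R : realType} (n : nat) (a b : R) : set 'rV[R]_n :=
  [set v | forall i, v ord0 i \in `[a, b]].

Lemma measurable_cube {R : realType} n (a b : R) : measurable (cube n a b).
Proof.
rewrite (_ : cube n a b = \bigcap_(i in [set: 'I_n]) (coord_rV i @^-1` `[a, b])).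
  apply: fin_bigcap_measurable; first exact: finite_finset.
  move=> i _; rewrite -[X in measurable X]setTI.
  exact: measurable_coord_rV.
by apply/seteqP; split => v /= vab i; [move=> _; exact: vab|exact: vab].
Qed.

Lemma lebesgue_rV_cube {R : realType} n (a b : R) : a <= b ->
  lebesgue_rV n (cube n a b) = ((b - a) ^+ n)%:E.
Proof.
move=> ab; elim: n => [|n IHn].
  by rewrite /= diracE mem_set//= => -[].
have cubeS : cons_rV @^-1` cube n.+1 a b = `[a, b]%classic `*` cube n a b.
  apply/seteqP; split => [[r v] /= rv|[r v] /= [ra vab] i].
    split; first by have := rv ord0; rewrite cons_rV0.
    by move=> i; have := rv (lift ord0 i); rewrite cons_rVS.
  by case: (unliftP ord0 i) => [j ->|->]; rewrite ?cons_rV0 ?cons_rVS//=.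
rewrite /= /lebesgue_rV_step /pushforward cubeS.
transitivity (lebesgue_measure `[a, b]%classic * lebesgue_rV n (cube n a b))%E.
  by apply: product_measure1E => //; exact: measurable_cube.
rewrite lebesgue_measure_itv/= lte_fin IHn exprS.
by move: ab; rewrite le_eqVlt => /predU1P[<-|->//]; rewrite ltxx subrr mul0r mul0e.
Qed.

Lemma integral_indic_cube {R : realType} n (a b : R) : a <= b ->
  (\int[@lebesgue_rV R n]_x (\1_(cube n a b) x)%:E = ((b - a) ^+ n)%:E)%E.
Proof.
move=> ab; have mcube := measurable_cube n a b.
by rewrite integral_indic// setIT; exact: lebesgue_rV_cube.
Qed.

Lemma integrable_indic_cube {R : realType} n (a b : R) : a <= b ->
  (@lebesgue_rV R n).-integrable setT (EFin \o \1_(cube n a b)).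
Proof.
move=> ab; have mcube := measurable_cube n a b.
apply/integrableP; split; first exact/measurable_EFinP/measurable_indic.
rewrite (eq_integral (fun x => (\1_(cube n a b) x)%:E)) => [|y _].
  by rewrite integral_indic_cube// ltry.
by rewrite gee0_abs// lee_fin.
Qed.

Lemma compact_cube {R : realType} n (a b : R) : compact (cube n a b).
Proof.
apply: (@rV_compact _ n (fun=> `[a, b]%classic)) => _; exact: segment_compact.
Qed.

Lemma compact_support_cube {R : realType} n (phi : 'rV[R]_n -> R) :
  compact (closure [set x | phi x != 0]) ->
  exists2 rho, 0 <= rho & forall x, phi x != 0 -> cube n (- rho) rho x.
Proof.
move=> /compact_bounded[M [Mreal AM]].
(* Boundedness holds for every radius strictly above [M], and balls of the sup norm are cubes. *)
exists (`|M| + 1) => [|x phix i]; first by rewrite addr_ge0.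
have ltM : M < `|M| + 1 by rewrite (le_lt_trans (ler_norm _))// ltrDl.
have /= := AM _ ltM x (@subset_closure _ [set y | phi y != 0] _ phix).
rewrite in_itv/= -ler_norml; apply: le_trans.
rewrite [leRHS]/Num.norm/= mx_normrE; apply/bigmax_geP; right.
by exists (ord0, i).
Qed.

Lemma integrable_cube_bounded {R : realType} {n} (psi : 'rV[R]_n -> R) (rho M : R) :
  0 <= rho -> measurable_fun setT psi -> (forall x, 0 <= psi x <= M) ->
  (forall x, psi x != 0 -> cube n (- rho) rho x) ->
  (@lebesgue_rV R n).-integrable setT (EFin \o psi).
Proof.
move=> rho0 mpsi psiM supp.
have icube : (@lebesgue_rV R n).-integrable setT
    (EFin \o (fun x => M * \1_(cube n (- rho) rho) x)).
  apply: (@integrableZl _ _ _ _ _ measurableT M (EFin \o \1_(cube n (- rho) rho))).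
  by apply: integrable_indic_cube; lra.
apply: le_integrable icube => //; first exact/measurable_EFinP.
move=> x _ /=; rewrite lee_fin ger0_norm; last by case/andP: (psiM x).
apply: (le_trans _ (ler_norm _)).
have [->|psix] := eqVneq (psi x) 0.
  by rewrite mulr_ge0 ?indicE//; case/andP: (psiM x); exact: le_trans.
by rewrite indicE mem_set ?mulr1; [case/andP: (psiM x)|exact: supp].
Qed.

(** * Eventual log-concavity *)

Lemma integrable_gauss_mul {R : realType} {n} (psi : 'rV[R]_n -> R) x t : 0 < t ->
  (forall y, 0 <= psi y) -> (@lebesgue_rV R n).-integrable setT (EFin \o psi) ->
  (@lebesgue_rV R n).-integrable setT
    (EFin \o (fun y => expR (- (sqdist x y / (4 * t))) * psi y)).
Proof.
move=> t0 psi0 ipsi.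
apply: (integrable_bounded_mul _ 1) => //; first exact: measurable_gauss.
move=> y _; rewrite ger0_norm ?expR_ge0// expR_le1 oppr_le0.
rewrite divr_ge0 ?sumr_ge0// => [i _|]; first exact: sqr_ge0.
by rewrite mulr_ge0// ltW.
Qed.

(* Each point [z] carries a supporting exponential: the function is at most
   [I z * expR (l * m)] along the line [z + l *: h]. *)
Lemma gauss_supporting_exp {R : realType} {n} {psi : 'rV[R]_n -> R} {rho t : R} :
  0 < t -> 8 * n%:R ^+ 2 * rho ^+ 2 <= t -> 0 <= rho ->
  (@lebesgue_rV R n).-integrable setT (EFin \o psi) ->
  (forall x, 0 <= psi x) ->
  (forall x, psi x != 0 -> cube n (- rho) rho x) ->
  let I x := (\int[@lebesgue_rV R n]_y (expR (- (sqdist x y / (4 * t))) * psi y))%R in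
  forall z h, 0 < I z -> exists m, forall l, I (z + l *: h) <= I z * expR (l * m).
Proof.
move=> t0 tn rho0 ipsi psi0 supp I z h Iz0.
have t4 : 4 * t != 0 by rewrite gt_eqF// mulr_gt0.
pose g y := expR (- (sqdist z y / (4 * t))) * psi y.
(* Expanding the square, the exponent at [z + l *: h] is the one at [z] plus
   [l * s y - l ^+ 2 * H / (4 * t)]. The value [c] is [s] at the centre 0 of the support cube, and
   [b] bounds the deviation of [s] from [c] on that cube. *)
pose s (y : 'rV[R]_n) := (\sum_i h ord0 i * (y ord0 i - z ord0 i)) / (2 * t).
pose c := (\sum_i h ord0 i * (- z ord0 i)) / (2 * t).
pose H := \sum_i h ord0 i ^+ 2.
pose b := n%:R * (Num.sqrt H * rho) / (2 * t).
have H0 : 0 <= H by apply: sumr_ge0 => i _; exact: sqr_ge0.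
have hH i : `|h ord0 i| <= Num.sqrt H.
  rewrite -sqrtr_sqr ler_sqrt// /H (bigD1 i)//= lerDl.
  by apply: sumr_ge0 => j _; exact: sqr_ge0.
have g0 y : 0 <= g y by rewrite mulr_ge0// expR_ge0.
have ig : (@lebesgue_rV R n).-integrable setT (EFin \o g).
  exact: integrable_gauss_mul.
have ms : measurable_fun setT s.
  apply: measurable_funM => //; apply: measurable_sum => i.
  apply: measurable_funM => //; apply: measurable_funB => //.
  exact: measurable_coord_rV.
have scb y : g y != 0 -> `|s y - c| <= b.
  rewrite /g mulf_eq0 negb_or => /andP[_ /supp ycube].
  rewrite /s /c -mulrBl -sumrB.
  rewrite (eq_bigr (fun i => h ord0 i * y ord0 i)); last by move=> i _; ring.
  rewrite normrM (ger0_norm (_ : 0 <= (2 * t)^-1)); last first.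
    by rewrite invr_ge0 mulr_ge0// ltW.
  rewrite ler_wpM2r ?invr_ge0 ?mulr_ge0 ?(ltW t0)//.
  apply: (le_trans (ler_norm_sum _ _ _)).
  rewrite -[X in _ <= X%:R * _](card_ord n) mulr_natl -sumr_const.
  apply: ler_sum => i _; rewrite normrM ler_pM//.
  by have := ycube i; rewrite in_itv/= -ler_norml.
have [m Im] := exp_moment_le g0 ig ms scb Iz0.
exists m => l.
have Il : I (z + l *: h) =
    (\int[@lebesgue_rV R n]_y (expR (l * s y) * g y))%R * expR (- (l ^+ 2 * H / (4 * t))).
  rewrite -RintegralZr//; last first.
    apply: (integrable_bounded_mul _ (expR (`|l| * (`|c| + b)))) => //.
      by apply: measurableT_comp => //; exact: measurable_funM.
    move=> x /scb sb; rewrite ger0_norm ?expR_ge0// ler_expR.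
    apply: (le_trans (ler_norm _)); rewrite normrM ler_wpM2l//.
    by have := ler_normD (s x - c) c; rewrite subrK; lra.
  apply: eq_Rintegral => y _; rewrite /g.
  have -> : - (sqdist (z + l *: h) y / (4 * t)) =
      l * s y + - (sqdist z y / (4 * t)) + - (l ^+ 2 * H / (4 * t)).
    rewrite /s /H /sqdist !mulr_suml !mulr_sumr !mulr_suml -!sumrN -!big_split/=.
    by apply: eq_bigr => i _; rewrite !mxE; field; rewrite gt_eqF.
  by rewrite !expRD; ring.
rewrite Il.
apply: (le_trans (ler_wpM2r (expR_ge0 _) (Im l))).
rewrite mulrAC -expRD mulrC ler_wpM2l ?(ltW Iz0)// ler_expR.
(* The Gaussian factor must absorb the moment bound: [8 * b ^+ 2] is [H / (4 * t)] times
   [8 * n%:R ^+ 2 * rho ^+ 2 / t], which explains the threshold on [t]. *)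
suff : 8 * b ^+ 2 <= H / (4 * t).
  by move=> /(ler_wpM2l (sqr_ge0 l)); rewrite [(l * b) ^+ 2]exprMn; lra.
rewrite /b !exprMn sqr_sqrtr// exprVn.
rewrite [leLHS](_ : _ = H / (4 * t) * (8 * n%:R ^+ 2 * rho ^+ 2 / t)); last first.
  by field; rewrite gt_eqF.
by rewrite ler_piMr ?ler_pdivrMr ?mul1r// divr_ge0// mulr_ge0// ltW.
Qed.

(** At the intermediate point [z], [ln I] lies below an affine function of [l]. The points [x] and
    [y] sit at [l = - mu] and [l = 1 - mu], and in the weighted average the slope cancels. *)
Lemma ln_concave_of_supporting_exp {R : realType} {V : lmodType R} {I : V -> R} :
  (forall x, 0 < I x) ->
  (forall z h, exists m, forall l, I (z + l *: h) <= I z * expR (l * m)) ->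
  forall x y (mu : R), 0 < mu -> mu < 1 ->
  (1 - mu) * ln (I x) + mu * ln (I y) <= ln (I ((1 - mu) *: x + mu *: y)).
Proof.
move=> I0 Isupp x y mu mu0 mu1.
set z := _ *: x + _; have [m Im] := Isupp z (y - x).
have ltI l : ln (I (z + l *: (y - x))) <= ln (I z) + l * m.
  rewrite -[l * m]expRK -lnM ?posrE ?expR_gt0//.
  rewrite ler_ln ?posrE// ?mulr_gt0 ?expR_gt0//.
have zE : z = x + mu *: (y - x).
  by rewrite /z scalerBl scale1r scalerBr -addrA [- _ + _]addrC.
have xE : x = z + (- mu) *: (y - x) by rewrite zE scaleNr addrK.
have yE : y = z + (1 - mu) *: (y - x).
  by rewrite zE -addrA -scalerDl subrKC scale1r subrKC.
have := ltI (- mu); rewrite -{}xE => ltx.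
have := ltI (1 - mu); rewrite -{}yE => lty.
nra.
Qed.

(** The Borel minorant inherits support and bound from [phi]; agreeing with it almost everywhere, it
    has the same convolution at every point and positive time. *)
Lemma classL_borel_representative {R : realType} {n} (phi : 'rV[R]_n -> R) :
  classL phi -> exists psi rho, [/\ 0 <= rho,
    forall x, psi x != 0 -> cube n (- rho) rho x,
    (forall x, 0 <= psi x) /\ (@lebesgue_rV R n).-integrable setT (EFin \o psi),
    ~ {ae @lebesgue_rV R n, forall x, psi x = 0}
  & forall x t, 0 < t -> U (n%:R / 2) phi x t =
      (\int[@lebesgue_rV R n]_y (expR (- (sqdist x y / (4 * t))) * psi y))%R].
Proof.
move=> [mphi phiN0 phi0 [M phiM] /compact_support_cube[rho rho0 supp]].
have [psi [mpsi psi0 psi_phi aepsi]] := borel_minorant mphi phi0.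
have psi_supp x : psi x != 0 -> cube n (- rho) rho x.
  move=> psix; apply: supp; apply: contra_neq psix => phix.
  by apply/eqP; rewrite eq_le psi0 -phix psi_phi.
exists psi, rho; split => //.
- split=> //; apply: (@integrable_cube_bounded _ _ _ rho M) => // x.
  by rewrite psi0 (le_trans (psi_phi x)).
- move=> psiae0; apply: phiN0; near=> x.
  have <- : psi x = phi x by near: x.
  by near: x.
- move=> x t t0; rewrite U_half_dim//; congr fine.
  apply: ge0_integral_minorant.
  + apply/measurable_EFinP; apply: measurable_funM => //.
    exact: measurable_gauss.
  + by move=> y; rewrite lee_fin mulr_ge0// expR_ge0.
  + by move=> y; rewrite lee_fin ler_pM2l// expR_gt0.
  + by apply: filterS aepsi => y ->.
Unshelve. all: by end_near. Qed.

(** The kernel vanishes nowhere, so a zero integral would force [psi] to vanish almost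
    everywhere. *)
Lemma gauss_integral_gt0 {R : realType} {n} (psi : 'rV[R]_n -> R) x t :
  0 < t -> (forall y, 0 <= psi y) ->
  (@lebesgue_rV R n).-integrable setT (EFin \o psi) ->
  ~ {ae @lebesgue_rV R n, forall y, psi y = 0} ->
  0 < (\int[@lebesgue_rV R n]_y (expR (- (sqdist x y / (4 * t))) * psi y))%R.
Proof.
move=> t0 psi0 ipsi psiN0.
have w_ge0 y : 0 <= expR (- (sqdist x y / (4 * t))) * psi y.
  by rewrite mulr_ge0// expR_ge0.
have iw : (@lebesgue_rV R n).-integrable setT
    (EFin \o (fun y => expR (- (sqdist x y / (4 * t))) * psi y)).
  exact: integrable_gauss_mul.
rewrite lt_neqAle Rintegral_ge0// andbT; apply/eqP => int0; apply: psiN0.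
have : (\int[@lebesgue_rV R n]_y
    `|(expR (- (sqdist x y / (4 * t))) * psi y)%:E| = 0)%E.
  under eq_integral do rewrite gee0_abs ?lee_fin//.
  have /fineK <- := integrable_fin_num measurableT iw.
  by rewrite -[fine _]int0.
move=> /ae_eq_integral_abs; move=> /(_ measurableT (measurable_int _ iw)).
apply: filterS => y /(_ Logic.I)/= [] /eqP.
by rewrite mulf_eq0 gt_eqF ?expR_gt0//= => /eqP.
Qed.

Lemma U_eventually_log_concave {R : realType} {n} (phi : 'rV[R]_n -> R) :
  classL phi -> eventually_concave logF (U (n%:R / 2) phi).
Proof.
move=> /classL_borel_representative[psi [rho [rho0 supp [psi0 ipsi] psiN0 UE]]].
have T0 : 0 <= 8 * n%:R ^+ 2 * rho ^+ 2 by rewrite !mulr_ge0// sqr_ge0.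
(* The summand 1 keeps the time positive when [rho] or [n] is zero. *)
exists (1 + 8 * n%:R ^+ 2 * rho ^+ 2); split; first lra.
move=> t tT; have t0 : 0 < t by lra.
have U0 x : 0 < U (n%:R / 2) phi x t by rewrite UE// gauss_integral_gt0.
split=> [x|x y mu mu0 mu1]; first exact: ltW.
rewrite /logF !lne_EFin// -!EFinM -EFinD lee_fin.
apply: (ln_concave_of_supporting_exp (I := (U (n%:R / 2) phi)^~ t)) => // z h.
have [||m zm] := @gauss_supporting_exp _ _ psi rho t t0 _ rho0 ipsi psi0 supp z h.
- lra.
- by rewrite gauss_integral_gt0.
by exists m => l; rewrite !UE.
Qed.

(** * The Gaussian profile of cube data *)

Lemma classL_cube {R : realType} {n} (C : R) : 0 < C ->
  classL (fun x : 'rV[R]_n => C * \1_(cube n 0 1) x).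
Proof.
move=> C0; split.
- move=> B mB; exists ((fun x => C * \1_(cube n 0 1) x) @^-1` B).
    rewrite -[X in measurable X]setTI.
    by apply: measurable_funM => //; exact: measurable_indic (measurable_cube _ _ _).
  by exists set0; [exact: negligible_set0|rewrite setU0].
- move=> ae0.
  have : (@lebesgue_rV R n).-negligible (cube n 0 1).
    apply: negligibleS ae0 => x cx /=; rewrite indicE mem_set// mulr1.
    by apply/eqP; rewrite gt_eqF.
  move=> /(negligibleP _ (measurable_cube n 0 1)) cube0.
  have := lebesgue_rV_cube n (0 : R) 1 ler01; rewrite subr0 expr1n => cube1.
  by have /eqP := etrans (esym cube0) cube1; rewrite eqe eq_sym oner_eq0.
- by move=> x; rewrite mulr_ge0// ltW.
- by exists C => x; rewrite ler_piMr ?(ltW C0)// indicE lern1 leq_b1.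
- apply: subclosed_compact (compact_cube n 0 1) _; first exact: closed_closure.
  have /closure_id {2}-> : closed (cube n (0 : R) 1).
    by apply: compact_closed (compact_cube n 0 1); exact: norm_hausdorff.
  apply: closureS => x /=; rewrite indicE; have [/set_mem//|] := boolP (x \in _).
  by rewrite mulr0 eqxx.
Qed.

(* In the self-similar variables [x = 2 sqrt t * r] the solution tends to the
   Gaussian [C * expR (- r ^+ 2)]; here [k = 1 / (2 sqrt t)]. *)
Lemma U_cube_bounds {R : realType} {n} (C r k : R) : 0 < C -> 0 < k -> k <= 1 ->
  let e := k * (2 * `|r| + 1 + n.+1%:R) in
  let u := U (n.+1%:R / 2) (fun x => C * \1_(cube n.+1 0 1) x)
             ((r / k) *: delta_mx ord0 ord0) (1 / (4 * k ^+ 2)) in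
  C * expR (- r ^+ 2 - e) <= u <= C * expR (- r ^+ 2 + e).
Proof.
move=> C0 k0 k1; cbv zeta; set e := k * _.
have k2 : 0 < 1 / (4 * k ^+ 2) by rewrite divr_gt0// mulr_gt0// exprn_gt0.
rewrite U_half_dim//.
set x := _ *: _.
pose w (y : 'rV[R]_n.+1) := expR (- (sqdist x y / (4 * (1 / (4 * k ^+ 2))))).
(* With [a] the first coordinate of [y] and [S] the contribution of the others, the exponent is [- r
   ^+ 2 + 2 * k * r * a - k ^+ 2 * (a ^+ 2 + S)]. Both corrections are controlled by [e], since [a]
   is in [[0, 1]], [S <= n.+1%:R] and [k <= 1]. *)
have dist y : cube n.+1 0 1 y ->
    - r ^+ 2 - e <= - (sqdist x y / (4 * (1 / (4 * k ^+ 2)))) <= - r ^+ 2 + e.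
  move=> cy; rewrite /sqdist (bigD1 ord0)//= !mxE eqxx mulr1.
  set S := \sum_(i < _ | _) _.
  have S0 : 0 <= S by apply: sumr_ge0 => i _; exact: sqr_ge0.
  have Sn : S <= n.+1%:R.
    have -> : n.+1%:R = \sum_(i < n.+1) 1 :> R by rewrite sumr_const card_ord.
    rewrite /S big_mkcond; apply: ler_sum => i _; case: ifPn => // /negbTE i0.
    rewrite !mxE eqxx i0 mulr0 sub0r sqrrN.
    by have := cy i; rewrite in_itv/= => /andP[? ?]; rewrite expr_le1.
  set a := y _ _.
  have [a0 a1] : 0 <= a /\ a <= 1 by have := cy ord0; rewrite in_itv/= => /andP[].
  have -> : ((r / k - a) ^+ 2 + S) / (4 * (1 / (4 * k ^+ 2))) =
      r ^+ 2 - k * (2 * (r * a)) + k * (k * (a ^+ 2 + S)).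
    by field; rewrite gt_eqF.
  have ra : - `|r| <= r * a <= `|r|.
    by rewrite -ler_norml normrM ler_piMr// ger0_norm.
  have kS : 0 <= k * (a ^+ 2 + S) <= 1 + n.+1%:R.
    apply/andP; split; first by rewrite mulr_ge0 ?addr_ge0 ?sqr_ge0// ltW.
    apply: (@le_trans _ _ (1 * (a ^+ 2 + S))).
      by rewrite ler_wpM2r// addr_ge0// sqr_ge0.
    by rewrite mul1r lerD// expr_le1.
  rewrite /e; move: ra kS => /andP[ra1 ra2] /andP[kS1 kS2].
  have := ler_wpM2l (ltW k0) ra1; have := ler_wpM2l (ltW k0) ra2.
  have := ler_wpM2l (ltW k0) kS1; have := ler_wpM2l (ltW k0) kS2.
  by move=> ? ? ? ?; apply/andP; split; lra.
have icube : (@lebesgue_rV R n.+1).-integrable setT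
    (EFin \o (fun x => C * \1_(cube n.+1 0 1) x)).
  apply: (@integrable_cube_bounded _ _ _ 1 C) => //.
  - by apply: measurable_funM => //; exact: measurable_indic (measurable_cube _ _ _).
  - by move=> y; rewrite mulr_ge0 ?(ltW C0)//= ler_piMr ?(ltW C0)// indicE lern1 leq_b1.
  - move=> y; rewrite indicE; have [/set_mem cy _ i|] := boolP (y \in _).
      by have := cy i; rewrite !in_itv/=; lra.
    by rewrite mulr0 eqxx.
(* The unit cube has volume 1, so constant bounds on the kernel pass unchanged to the integral. *)
have mass (a : R) : (\int[@lebesgue_rV R n.+1]_y (a * (C * \1_(cube n.+1 0 1) y)))%R = C * a.
  rewrite RintegralZl// RintegralZl//; last exact: integrable_indic_cube.
  by rewrite /Rintegral integral_indic_cube//= subr0 expr1n mulr1 mulrC.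
have iw : (@lebesgue_rV R n.+1).-integrable setT
    (EFin \o (fun y => w y * (C * \1_(cube n.+1 0 1) y))).
  apply: (integrable_bounded_mul _ (expR (- r ^+ 2 + e))) => //.
  - by move=> y; rewrite mulr_ge0// ltW.
  - exact: measurable_gauss.
  - move=> y; rewrite indicE; have [/set_mem cy _|] := boolP (y \in _).
      by rewrite ger0_norm ?expR_ge0// ler_expR; case/andP: (dist y cy).
    by rewrite mulr0 eqxx.
have icst (a : R) : (@lebesgue_rV R n.+1).-integrable setT
    (EFin \o (fun y => a * (C * \1_(cube n.+1 0 1) y))).
  exact: (@integrableZl _ _ _ _ _ measurableT a _ icube).
rewrite -!mass; apply/andP; split; apply: le_Rintegral => // y _.
- rewrite indicE; have [/set_mem cy|_] := boolP (y \in _); last by rewrite !mulr0.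
  by rewrite mulr1 ler_pM2r// ler_expR; case/andP: (dist y cy).
- rewrite indicE; have [/set_mem cy|_] := boolP (y \in _); last by rewrite !mulr0.
  by rewrite mulr1 ler_pM2r// ler_expR; case/andP: (dist y cy).
Qed.

(** * Concavity of [F] composed with the exponential *)

Lemma admissible_fineK {R : realType} {F : R -> \bar R} {r : R} :
  admissible F -> 0 < r -> (fine (F r))%:E = F r.
Proof.
move=> [Fy _ Fincr F0] r0; apply: fineK; rewrite fin_numE Fy ?ltW// andbT.
by have := Fincr 0 r (lexx 0) r0; rewrite F0 ltNye.
Qed.

Lemma admissible_expR_mono {R : realType} {F : R -> \bar R} : admissible F ->
  {homo (fun s => fine (F (expR s))) : s s' / s <= s'}.
Proof.
move=> aF s s'; rewrite le_eqVlt => /predU1P[->//|ss'].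
rewrite -lee_fin !admissible_fineK ?expR_gt0//; apply/ltW.
by case: aF => _ _ + _; apply; rewrite ?expR_ge0// ltr_expR.
Qed.

Lemma admissible_expR_continuous {R : realType} {F : R -> \bar R} : admissible F ->
  continuous (fun s => fine (F (expR s))).
Proof.
move=> aF s; apply: fine_cvg; rewrite admissible_fineK ?expR_gt0//.
have [_ + _ _] := aF; rewrite continuous_open_subspace; last exact: interval_open.
move=> /(_ (expR s)); rewrite inE/= in_itv/= expR_gt0 => /(_ isT) cF.
by apply: continuous_comp => //; exact: continuous_expR.
Qed.

(** [F]-concavity is tested on [expR c] times a cube indicator, at three collinear points and one
    late time. The slack [eps] covers the distance to the limiting Gaussian, and [F] is
    increasing. *)
Lemma eventually_concave_radial {R : realType} {n} {F : R -> \bar R} :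
  admissible F ->
  (forall phi : 'rV[R]_n.+1 -> R,
    classL phi -> eventually_concave F (U (n.+1%:R / 2) phi)) ->
  let G s := fine (F (expR s)) in
  forall c r1 r2 mu eps : R, 0 < mu -> mu < 1 -> 0 < eps ->
  (1 - mu) * G (c - r1 ^+ 2 - eps) + mu * G (c - r2 ^+ 2 - eps) <=
    G (c - ((1 - mu) * r1 + mu * r2) ^+ 2 + eps).
Proof.
move=> aF ev G c r1 r2 mu eps mu0 mu1 eps0.
have [T [T0 UF]] := ev _ (@classL_cube _ n.+1 _ (expR_gt0 c)).
pose r := (1 - mu) * r1 + mu * r2.
pose K := 2 * (`|r1| + `|r2|) + 1 + n.+1%:R.
have K0 : 0 <= K by rewrite !addr_ge0// mulr_ge0// addr_ge0.
have rK : `|r| <= `|r1| + `|r2|.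
  apply: (le_trans (ler_normD _ _)); rewrite !normrM ger0_norm; last lra.
  rewrite (ger0_norm (ltW mu0)).
  by have := normr_ge0 r1; have := normr_ge0 r2; nra.
(* The three summands give respectively [k <= 1], a time [1 / (4 * k ^+ 2)] past [T], and an error
   at most [eps] at [r1], [r2] and [r] alike. *)
pose k := (1 + 4 * T + K / eps)^-1.
have Ke : 0 <= K / eps by rewrite divr_ge0// ltW.
have k0 : 0 < k by rewrite invr_gt0; lra.
have kV : k * (1 + 4 * T + K / eps) = 1 by rewrite mulVf// gt_eqF//; lra.
have k1 : k <= 1 by nra.
have kT : k * (4 * T) <= 1 by nra.
have kK : k * K <= eps.
  by rewrite -[leRHS]mul1r -ler_pdivrMr// -mulrA; nra.
have tT : T <= 1 / (4 * k ^+ 2).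
  rewrite ler_pdivlMr ?mulr_gt0 ?exprn_gt0//.
  by have := ler_wpM2l (ltW k0) kT; lra.
have [_ UFt] := UF _ tT.
pose P s : 'rV[R]_n.+1 := (s / k) *: delta_mx ord0 ord0.
pose u s := U (n.+1%:R / 2) (fun x => expR c * \1_(cube n.+1 0 1) x) (P s)
  (1 / (4 * k ^+ 2)).
have bnd s : `|s| <= `|r1| + `|r2| ->
    expR (c - s ^+ 2 - eps) <= u s <= expR (c - s ^+ 2 + eps).
  move=> sK; have /andP[u1 u2] := @U_cube_bounds _ n _ s _ (expR_gt0 c) k0 k1.
  have ke : k * (2 * `|s| + 1 + n.+1%:R) <= eps.
    by apply: (le_trans _ kK); rewrite ler_wpM2l ?(ltW k0)// /K; lra.
  apply/andP; split; [apply: (le_trans _ u1)|apply: (le_trans u2)].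
    by rewrite -expRD ler_expR; lra.
  by rewrite -expRD ler_expR; lra.
have Fle (a b : R) : 0 < a -> a <= b -> (F a <= F b)%E.
  move=> a0; rewrite le_eqVlt => /predU1P[->//|ab].
  by apply: ltW; case: aF => _ _ + _; apply => //; exact: ltW.
have [s1 s2] : `|r1| <= `|r1| + `|r2| /\ `|r2| <= `|r1| + `|r2|.
  by rewrite lerDl lerDr !normr_ge0.
have /andP[b1 _] := bnd _ s1; have /andP[b2 _] := bnd _ s2.
have /andP[b3 b4] := bnd _ rK.
have UFr : ((1 - mu)%:E * F (u r1) + mu%:E * F (u r2) <= F (u r))%E.
  have := UFt (P r1) (P r2) mu mu0 mu1.
  have -> // : (1 - mu) *: P r1 + mu *: P r2 = P r.
  by rewrite /P !scalerA -scalerDl; congr (_ *: _); rewrite /r; ring.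
clearbody u.
have Fb1 := Fle _ _ (expR_gt0 _) b1; have Fb2 := Fle _ _ (expR_gt0 _) b2.
have Fb4 := Fle _ _ (lt_le_trans (expR_gt0 _) b3) b4.
rewrite -lee_fin EFinD !EFinM !admissible_fineK ?expR_gt0//.
apply: le_trans Fb4; apply: le_trans UFr.
by apply: leeD; apply: lee_wpmul2l; rewrite // lee_fin; lra.
Qed.

(* Far from the origin [c - r ^+ 2] is almost affine in [r]: for
   [c = 1 / (4 k^2)] and [r = 1 / (2 k) - k * v] it equals [v - k^2 v^2]. *)
Lemma concave_of_radial {R : realType} {G : R -> R} :
  {homo G : s s' / s <= s'} -> continuous G ->
  (forall c r1 r2 mu eps : R, 0 < mu -> mu < 1 -> 0 < eps ->
    (1 - mu) * G (c - r1 ^+ 2 - eps) + mu * G (c - r2 ^+ 2 - eps) <=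
      G (c - ((1 - mu) * r1 + mu * r2) ^+ 2 + eps)) ->
  forall v1 v2 mu : R, 0 < mu -> mu < 1 ->
  (1 - mu) * G v1 + mu * G v2 <= G ((1 - mu) * v1 + mu * v2).
Proof.
move=> Gmono Gcont Grad v1 v2 mu mu0 mu1.
set v := (1 - mu) * v1 + mu * v2.
have Geps eps : 0 < eps ->
    (1 - mu) * G (v1 - 2 * eps) + mu * G (v2 - 2 * eps) <= G (v + eps).
  move=> eps0; pose S := v1 ^+ 2 + v2 ^+ 2.
  have [S1 S2] : 0 <= v1 ^+ 2 /\ 0 <= v2 ^+ 2 by rewrite !sqr_ge0.
  have Se : 0 <= S / eps by rewrite divr_ge0 ?addr_ge0// ltW.
  (* Chosen so that [k ^+ 2 * v1 ^+ 2] and [k ^+ 2 * v2 ^+ 2] are at most [eps]; with the slack of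
     the hypothesis this makes [2 * eps]. *)
  pose k := (1 + S / eps)^-1.
  have k0 : 0 < k by rewrite invr_gt0; lra.
  have kV : k * (1 + S / eps) = 1 by rewrite mulVf// gt_eqF//; lra.
  have k1 : k <= 1 by nra.
  have kS : k * S <= eps by rewrite -[leRHS]mul1r -ler_pdivrMr// -mulrA; nra.
  have kkS : k ^+ 2 * S <= eps.
    apply: (le_trans _ kS); rewrite expr2 -mulrA ler_piMl//.
    by rewrite mulr_ge0 ?(ltW k0)// addr_ge0.
  pose rr s := 1 / (2 * k) - k * s; pose c := 1 / (4 * k ^+ 2).
  have crr s : c - rr s ^+ 2 = s - k ^+ 2 * s ^+ 2.
    by rewrite /c /rr; field; rewrite gt_eqF.
  have := Grad c (rr v1) (rr v2) mu eps mu0 mu1 eps0.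
  have -> : (1 - mu) * rr v1 + mu * rr v2 = rr v by rewrite /rr /v; ring.
  rewrite !crr => Gr.
  have le1 : G (v1 - 2 * eps) <= G (v1 - k ^+ 2 * v1 ^+ 2 - eps).
    by apply: Gmono; have := ler_wpM2l (sqr_ge0 k) S2; rewrite /S in kkS; lra.
  have le2 : G (v2 - 2 * eps) <= G (v2 - k ^+ 2 * v2 ^+ 2 - eps).
    by apply: Gmono; have := ler_wpM2l (sqr_ge0 k) S1; rewrite /S in kkS; lra.
  have le3 : G (v - k ^+ 2 * v ^+ 2 + eps) <= G (v + eps).
    by apply: Gmono; have := mulr_ge0 (sqr_ge0 k) (sqr_ge0 v); lra.
  apply: (le_trans _ (le_trans Gr le3)).
  by apply: lerD; apply: ler_wpM2l => //; lra.
(* Continuity of [G] now removes the slack as [eps] decreases to 0. *)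
have Gcvg (a b : R) : G (a + b * e) @[e --> 0^'+] --> G a.
  apply: cvg_at_right_filter.
  have abcvg : a + b * e @[e --> 0] --> a + b * 0.
    by apply: cvgD; [exact: cvg_cst|apply: cvgM; [exact: cvg_cst|exact: cvg_id]].
  by rewrite mulr0 addr0 in abcvg; exact: cvg_comp abcvg (Gcont a).
have lcvg : (1 - mu) * G (v1 + (- 2) * e) + mu * G (v2 + (- 2) * e) @[e --> 0^'+]
    --> (1 - mu) * G v1 + mu * G v2.
  by apply: cvgD; apply: cvgM => //; exact: cvg_cst.
apply: (ler_cvg_to lcvg (Gcvg v 1)).
near=> e; have e0 : 0 < e by near: e; exact: nbhs_right_gt.
by rewrite mul1r !mulNr; exact: Geps.
Unshelve. all: by end_near. Qed.

(** Where [f] is positive, log-concavity bounds the logarithm of [f] at the intermediate point from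
    below by the mean of the logarithms, and [G] is increasing and concave. *)
Lemma weaker_than_log_of_concave_expR {R : realType} {n} {F : R -> \bar R} :
  admissible F ->
  (let G s := fine (F (expR s)) in forall v1 v2 mu : R, 0 < mu -> mu < 1 ->
    (1 - mu) * G v1 + mu * G v2 <= G ((1 - mu) * v1 + mu * v2)) ->
  weaker_concavity n F logF.
Proof.
move=> aF Gconc f [f0 flog]; split=> // x y mu mu0 mu1.
have F0 : F 0 = -oo%E by case: aF.
(* A zero of [f] at an endpoint makes the left side [-oo], both weights being positive. *)
have [fx0|fx0] := eqVneq (f x) 0.
  by rewrite fx0 F0 mulrNy gtr0_sg ?subr_gt0// mul1e addNye leNye.
have [fy0|fy0] := eqVneq (f y) 0.
  by rewrite fy0 F0 [X in (_ + X)%E]mulrNy gtr0_sg// mul1e addeNy leNye.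
have {fx0}fx : 0 < f x by rewrite lt_neqAle eq_sym fx0 f0.
have {fy0}fy : 0 < f y by rewrite lt_neqAle eq_sym fy0 f0.
have := flog x y mu mu0 mu1; rewrite /logF (lne_EFin fx) (lne_EFin fy).
(* A zero at the intermediate point would put a finite mean of logarithms below [-oo]. *)
set z := f (_ + _); have [z0|z0] := leP z 0.
  by rewrite le0_lneNy ?lee_fin// -!EFinM -EFinD leeNy_eq.
rewrite lne_EFin// -!EFinM -EFinD lee_fin => lnz.
rewrite -(admissible_fineK aF fx) -(admissible_fineK aF fy) -(admissible_fineK aF z0).
rewrite -!EFinM -EFinD lee_fin.
have := Gconc (ln (f x)) (ln (f y)) mu mu0 mu1; rewrite /= !lnK ?posrE//.
move=> /le_trans; apply; rewrite -[in leRHS](lnK z0).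
exact: admissible_expR_mono.
Qed.

Theorem theorem1p4 (R : realType) (n : nat) (F : R -> \bar R) :
  (1 <= n)%N -> admissible F ->
  ((forall phi : 'rV[R]_n -> R,
      classL phi -> eventually_concave F (U (n%:R / 2) phi))
   <-> weaker_concavity n F logF).
Proof.
(* Writing the dimension as a successor provides the first coordinate axis, along which the cube
   data are tested. *)
case: n => // n _ aF; split=> [ev|wF phi /U_eventually_log_concave[T [T0 UT]]].
  apply: (weaker_than_log_of_concave_expR aF).
  exact: (concave_of_radial (admissible_expR_mono aF)
    (admissible_expR_continuous aF) (eventually_concave_radial aF ev)).
by exists T; split=> // t /UT; exact: wF.
Qed.
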